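(* Let $\Sigma$ be a finite non-empty alphabet with $|\Sigma|=k$. If each factor of a recurrent infinite word over the alphabet $\Sigma$ has at most $k$ abelian returns, then the word is periodic.
   Context: Infinite words are right infinite words $w=w_1w_2\cdots$ with letters in $\Sigma$. A factor of $w$ is a finite block of consecutive letters occurring in $w$. $|u|$ is the length of a finite word $u$, and $|u|_a$ is the number of occurrences of the letter $a$ in $u$. The word $w$ is periodic if there is an integer $T\ge 1$ such that $w_{n+T}=w_n$ for every $n$. It is recurrent if each of its factors occurs infinitely many times in $w$. Finite words $u,v$ are abelian equivalent, written $u\approx^{ab}v$, if $|u|_a=|v|_a$ for all $a\in\Sigma$. For a recurrent infinite word $w$ and a factor $u$ of $w$, let $n_1<n_2<\cdots$ be all the integers $n_i$ such that $w_{n_i}\cdots w_{n_i+|u|-1}\approx^{ab}u$. Each word $w_{n_i}\cdots w_{n_{i+1}-1}$ is called an abelian return of $u$ in $w$. The number of abelian returns of $u$ is the number of abelian equivalence classes in the set of its abelian returns.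
   Formalization: The word is assumed to use every letter of Σ; without this the claim fails, e.g. for a Sturmian word viewed over a three-letter alphabet, which is recurrent and aperiodic with at most three abelian returns per factor. *)

(* Defs.v *)
From mathcomp Require Import all_boot.
From mathcomp Require Import boolp classical_sets functions cardinality.

Set Implicit Arguments.
Unset Strict Implicit.
Unset Printing Implicit Defensive.

Local Open Scope classical_set_scope.
Local Open Scope card_scope.

(* Infinite words are functions [w : nat -> Sigma]; positions start at 0. *)

Definition block (Sigma : finType) (w : nat -> Sigma) (n l : nat) : seq Sigma :=
  [seq w i | i <- iota n l].

Definition occurs_at (Sigma : finType) (w : nat -> Sigma) (u : seq Sigma)
    (n : nat) : Prop :=
  block w n (size u) = u.

Definition is_factor (Sigma : finType) (w : nat -> Sigma) (u : seq Sigma) : Prop :=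
  exists n : nat, occurs_at w u n.

Definition periodic (Sigma : finType) (w : nat -> Sigma) : Prop :=
  exists T : nat, 1 <= T /\ forall n : nat, w (n + T) = w n.

Definition recurrent (Sigma : finType) (w : nat -> Sigma) : Prop :=
  forall u : seq Sigma, is_factor w u ->
  forall N : nat, exists n : nat, N <= n /\ occurs_at w u n.

(* A word is over the alphabet [Sigma] when [Sigma] is exactly its set of
   letters. This is needed: a Sturmian word viewed over a 3-letter type is
   aperiodic although its factors have at most 3 abelian returns. *)
Definition word_over_alphabet (Sigma : finType) (w : nat -> Sigma) : Prop :=
  forall a : Sigma, exists n : nat, w n = a.

Definition ab_equiv (Sigma : finType) (u v : seq Sigma) : Prop :=
  forall a : Sigma, count_mem a u = count_mem a v.

Definition ab_occurs_at (Sigma : finType) (w : nat -> Sigma) (u : seq Sigma)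
    (n : nat) : Prop :=
  ab_equiv (block w n (size u)) u.

(* [m < n] are consecutive terms of the increasing enumeration of the
   positions satisfying [ab_occurs_at w u]. *)
Definition consecutive_ab_occurrences (Sigma : finType) (w : nat -> Sigma)
    (u : seq Sigma) (m n : nat) : Prop :=
  [/\ m < n, ab_occurs_at w u m, ab_occurs_at w u n &
      forall j : nat, m < j -> j < n -> ~ ab_occurs_at w u j].

Definition ab_returns (Sigma : finType) (w : nat -> Sigma) (u : seq Sigma) :
    set (seq Sigma) :=
  [set v | exists m n : nat,
     consecutive_ab_occurrences w u m n /\ v = block w m (n - m)].

Definition ab_class (Sigma : finType) (v : seq Sigma) : set (seq Sigma) :=
  [set v' | ab_equiv v v'].

Definition ab_return_classes (Sigma : finType) (w : nat -> Sigma)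
    (u : seq Sigma) : set (set (seq Sigma)) :=
  [set ab_class v | v in ab_returns w u].

Definition at_most_ab_returns (Sigma : finType) (w : nat -> Sigma)
    (u : seq Sigma) (k : nat) : Prop :=
  ab_return_classes w u #<= `I_k.

(* Main.v *)
Require Import Defs.
From mathcomp Require Import all_boot.
From mathcomp Require Import boolp classical_sets functions cardinality.

Set Implicit Arguments.
Unset Strict Implicit.
Unset Printing Implicit Defensive.

(**
  Let [v] be a prefix of [w] containing every letter, let [n > 0] be a later
  occurrence of [v], and let [u] be the prefix of length [n].  While the window
  of length [n] slides over [v], the letters entering and leaving agree, so it
  stays abelian equivalent to [u]: every letter is an abelian return of [u].
  These are already [k] classes, so no abelian return is longer; hence the
  window slides forever within the class of [u], and [w] has period [n].
*)

Section Blocks.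
Variables (Sigma : finType) (w : nat -> Sigma).

Lemma size_block n l : size (block w n l) = l.
Proof. by rewrite size_map size_iota. Qed.

(** Both sides count [a] in the block of length [l.+1] at [n], split off at its first or at its last
    letter. *)
Lemma count_block_slide (a : Sigma) n l :
  (w n == a) + count_mem a (block w n.+1 l) =
  count_mem a (block w n l) + (w (n + l) == a).
Proof.
have E : w n :: block w n.+1 l = rcons (block w n l) (w (n + l)).
  by rewrite /block -map_rcons -cats1 -(iotaD n l 1) addn1.
by have /= -> := congr1 (count_mem a) E; rewrite -cats1 count_cat /= addn0.
Qed.

Lemma ab_equiv_slide n l (u : seq Sigma) :
  ab_equiv (block w n l) u ->
  ab_equiv (block w n.+1 l) u <-> w (n + l) = w n.
Proof.
move=> nu; split=> [Su | wE a].
  (* It is enough to count the leaving letter [w n]: its number is unchanged only if the entering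
     letter is [w n] too. *)
  have := count_block_slide (w n) n l.
  rewrite nu Su eqxx addnC => /addnI; by case: eqP.
by have := count_block_slide a n l; rewrite nu wE addnC => /addIn.
Qed.

Lemma next_ab_occurrence (u : seq Sigma) m :
    recurrent w -> is_factor w u -> ab_occurs_at w u m ->
  exists n, consecutive_ab_occurrences w u m n.
Proof.
move=> w_rec wu mu.
(* Recurrence provides a later exact occurrence of [u], which is also an abelian one; the least
   abelian one after [m] is the next. *)
have exP : exists n, (m < n) && `[< ab_occurs_at w u n >].
  have [n [mn un]] := w_rec u wu m.+1.
  by exists n; rewrite mn; apply/asboolP; rewrite /ab_occurs_at un.
case: (ex_minnP exP) => n /andP[mn /asboolP nu] n_min.
exists n; split=> // j mj jn ju.
suff : n <= j by rewrite leqNgt jn.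
by apply: n_min; rewrite mj; apply/asboolP.
Qed.

Lemma prefix_with_all_letters :
  word_over_alphabet w -> exists l, forall a, a \in block w 0 l.
Proof.
move=> /choice[p wp]; exists (\max_a p a).+1 => a.
by rewrite -(wp a) map_f // mem_iota add0n ltnS leq_bigmax.
Qed.

End Blocks.

Lemma ab_class_inj (Sigma : finType) (u v : seq Sigma) :
  ab_class u = ab_class v -> ab_equiv u v.
Proof. by move=> E; have : ab_class v v by []; rewrite -E. Qed.

Lemma ab_equiv_perm (Sigma : finType) (u v : seq Sigma) :
  ab_equiv u v -> perm_eq u v.
Proof. by move=> uv; rewrite /perm_eq; apply/allP => a _; apply/eqP. Qed.

Lemma card_le_II_inj (I : finType) (T : Type) (A : set T) (k : nat)
    (f : I -> T) :
  injective f -> (forall i, A (f i)) -> (A #<= `I_k)%card -> #|I| <= k.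
Proof.
move=> f_inj fA Ak; rewrite -card_le_II; apply: card_le_trans Ak.
pose g (i : 'I_#|I|) := f (enum_val i).
have g_inj : {in [set: 'I_#|I|]%classic &, injective g}.
  by move=> i j _ _ /f_inj/enum_val_inj.
have /card_eqPle[_ cg] := inj_card_eq g_inj.
have /card_eqPle[cI _] := @card_II #|I|.
apply: card_le_trans cI (card_le_trans cg _).
by apply: subset_card_le => _ [i _ <-]; apply: fA.
Qed.

Lemma ab_return_is_letter (Sigma : finType) (w : nat -> Sigma)
    (u v : seq Sigma) :
    (forall a, ab_returns w u [:: a]) ->
    at_most_ab_returns w u #|Sigma| ->
  ab_returns w u v -> size v = 1.
Proof.
move=> letters few uv; apply/eqP/negP => /negP szv.
(* [None] adds the class of [v] to those of the letters; it is a new class because lengths differ,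
   which makes [#|Sigma|.+1] classes in all. *)
pose f (o : option Sigma) := ab_class (if o is Some a then [:: a] else v).
have f_inj : injective f.
  move=> o o' /ab_class_inj/ab_equiv_perm.
  case: o o' => [a|] [b|] //= E.
  - by have := perm_mem E a; rewrite !inE eqxx => /esym/eqP->.
  - by rewrite -(perm_size E) in szv.
  - by rewrite (perm_size E) in szv.
have fP o : ab_return_classes w u (f o) by case: o => [a|]; [exists [:: a] | exists v].
by have := card_le_II_inj f_inj fP few; rewrite card_option ltnn.
Qed.

Theorem lemma1 (Sigma : finType) (k : nat) (Sigma_nonempty : 0 < #|Sigma|)
    (card_Sigma : #|Sigma| = k) (w : nat -> Sigma)
    (w_over : word_over_alphabet w) (w_rec : recurrent w)
    (w_returns : forall u : seq Sigma, is_factor w u -> at_most_ab_returns w u k) :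
  periodic w.
Proof.
have [l lP] := prefix_with_all_letters w_over.
have v_factor : is_factor w (block w 0 l).
  by exists 0; rewrite /occurs_at size_block.
(* The bound 1 excludes the occurrence at 0, so that [n] can serve as a period. *)
have [n [n_gt0]] := w_rec _ v_factor 1.
rewrite /occurs_at size_block => vE.
have v_period j : j < l -> w (j + n) = w j.
  move=> jl; have := congr1 (nth (w 0) ^~ j) vE.
  by rewrite !(nth_map 0) ?size_iota ?nth_iota // add0n addnC.
set u := block w 0 n.
have su : size u = n by rewrite size_block.
have u_factor : is_factor w u by exists 0; rewrite /occurs_at su.
have slide j : ab_occurs_at w u j ->
    ab_occurs_at w u j.+1 <-> w (j + n) = w j.
  by rewrite /ab_occurs_at su; apply: ab_equiv_slide.
(* The case [j = l] is included since the return starting at the last letter of the prefix ends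
   there. *)
have u_over_v j : j <= l -> ab_occurs_at w u j.
  elim: j => [|j IH] jl; first by rewrite /ab_occurs_at su.
  by apply/slide; [apply/IH/ltnW | apply: v_period].
have letters a : ab_returns w u [:: a].
  have /mapP[j] := lP a; rewrite mem_iota add0n => /= jl ->.
  exists j, j.+1; split; last by rewrite subSnn.
  split=> //; [exact/u_over_v/ltnW | exact: u_over_v |].
  by move=> i ji; rewrite ltnS leqNgt ji.
have u_everywhere j : ab_occurs_at w u j.
  elim: j => [|j IH]; first exact: u_over_v.
  have [m jm] := next_ab_occurrence w_rec u_factor IH.
  have few : at_most_ab_returns w u #|Sigma|.
    by rewrite card_Sigma; apply: w_returns.
  (* The return from [j] to the next occurrence [m] has length 1, so [m] is [j.+1]. *)
  have := ab_return_is_letter letters few (ex_intro _ j (ex_intro _ m (conj jm erefl))).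
  case: jm => jm _ mu _; rewrite size_block => mj.
  by rewrite -addn1 -mj subnKC // ltnW.
by exists n; split=> // j; apply/slide.
Qed.
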